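(* Let $G$ be a simple connected graph with $N_0^k$ vertices and $E_0^k\ge1$ edges, and let $k\ge2$, $n\ge1$ be integers. The number of spanning trees of the $n$-th $k$-hexagonal graph $H^k_n(G)$ is $$\tau(H^k_n(G))=(k+5)^{N_0^k+\frac45\left((5k+1)^{n-1}-1\right)E_0^k-1}\cdot5^{\left[\frac{5k-4}{5}(5k+1)^{n-1}+\frac45\right]E_0^k-N_0^k+1}\cdot\tau(H^k_{n-1}(G)),$$ and the general expression is $$\tau(H^k_n(G))=(k+5)^{n\left(N_0^k-\frac45E_0^k-1\right)+\frac45\xi E_0^k}\cdot5^{n\left(\frac45E_0^k-N_0^k+1\right)+\frac{5k-4}{5}\xi E_0^k}\cdot\tau(G),$$ where $$\xi=\sum_{i=0}^{n-1}(5k+1)^i=\frac{(5k+1)^n-1}{5k}.$$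
   Context: Graphs are finite, simple and connected. The superscript $k$ in $N_0^k$, $E_0^k$ is an index, not a power: these are simply the order and size of $H^k_0(G)=G$. The $k$-hexagonal graph $H^k(G)$ of $G$ is obtained by replacing each edge $uv$ of $G$ by $k+1$ internally disjoint $u$–$v$ paths, one of length $1$ (the edge $uv$ itself) and $k$ of length $5$ (each with 4 new internal vertices). Set $H^k_0(G)=G$ and $H^k_n(G)=H^k(H^k_{n-1}(G))$ for $n\ge1$. $\tau(F)$ denotes the number of spanning trees of a graph $F$. *)

(* Defs.v *)
From HB Require Import structures.
From mathcomp Require Import all_boot.
From mathcomp Require Import boolp.

Set Implicit Arguments.
Unset Strict Implicit.
Unset Printing Implicit Defensive.

Record sgraph := SGraph {
  vertex :> finType;
  adj : rel vertex;
  adj_sym : symmetric adj;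
  adj_irrefl : irreflexive adj
}.

Definition edges (G : sgraph) : {set {set G}} :=
  [set [set p.1; p.2] | p : G * G & adj p.1 p.2].

Definition is_connected (G : sgraph) : Prop :=
  forall x y : G, connect (@adj G) x y.

(* [ucycle] also accepts the closed walk [x; y] along a single edge; genuine
   cycles have at least three vertices. *)
Definition is_acyclic (G : sgraph) : Prop :=
  forall c : seq G, ucycle (@adj G) c -> size c <= 2.

Definition is_tree (G : sgraph) : Prop := is_connected G /\ is_acyclic G.

Section SpanningTrees.
Variables (G : sgraph).

Definition sub_adj (F : {set {set G}}) : rel G :=
  fun x y => adj x y && ([set x; y] \in F).

Lemma sub_adj_sym F : symmetric (sub_adj F).
Proof. by move=> x y; rewrite /sub_adj adj_sym setUC. Qed.

Lemma sub_adj_irrefl F : irreflexive (sub_adj F).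
Proof. by move=> x; rewrite /sub_adj adj_irrefl. Qed.

Definition spanning_subgraph (F : {set {set G}}) : sgraph :=
  SGraph (sub_adj_sym F) (sub_adj_irrefl F).

Definition tau : nat :=
  #|[set F in powerset (edges G) | `[< is_tree (spanning_subgraph F) >] ]|.

End SpanningTrees.

Section Hexagonal.
Variables (k : nat) (G : sgraph).

(* Each edge is represented once, as a pair oriented by the enumeration of the
   vertices; the orientation only serves to number the internal vertices of the
   added paths from [src] to [tgt]. *)
Definition oedge : finType :=
  {p : G * G | adj p.1 p.2 && (enum_rank p.1 < enum_rank p.2)}.

Definition src (e : oedge) : G := (val e).1.
Definition tgt (e : oedge) : G := (val e).2.

(* [inr (e, i, j)] is the [j]-th internal vertex of the [i]-th path
   src e -- (e,i,0) -- (e,i,1) -- (e,i,2) -- (e,i,3) -- tgt e. *)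
Definition hex_vertex : finType := (G + oedge * 'I_k * 'I_4)%type.

Definition hex_adj : rel hex_vertex := fun x y =>
  match x, y with
  | inl u, inl v => adj u v
  | inl u, inr (e, _, j) | inr (e, _, j), inl u =>
      (u == src e) && (j == 0 :> nat) || (u == tgt e) && (j == 3 :> nat)
  | inr (e, i, j), inr (e', i', j') =>
      [&& e == e', i == i' & (j.+1 == j' :> nat) || (j'.+1 == j :> nat)]
  end.

Lemma hex_adj_sym : symmetric hex_adj.
Proof.
move=> [u|[[e i] j]] [v|[[e' i'] j']] //=; first exact: adj_sym.
by rewrite (eq_sym e) (eq_sym i) orbC.
Qed.

Lemma hex_adj_irrefl : irreflexive hex_adj.
Proof.
move=> [u|[[e i] j]] /=; first exact: adj_irrefl.
by rewrite !eqxx /= gtn_eqF.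
Qed.

Definition hexagonal : sgraph := SGraph hex_adj_sym hex_adj_irrefl.

End Hexagonal.

Definition hexn (k n : nat) (G : sgraph) : sgraph := iter n (hexagonal k) G.

(* Main.v *)
Require Import Defs.
From mathcomp Require Import all_boot all_order all_algebra.
From mathcomp Require Import boolp reals exp.
From mathcomp Require Import zify ring.

(** A spanning tree is the same thing as a minimal set of edges that still
    connects all vertices ([tree_minspan]).  Seen this way, trees of the
    hexagonal graph can be understood one original edge at a time.

    Fix an edge [e = uv] of [G].  In [H^k(G)] it is replaced by [k + 1] branches
    joining [u] to [v]: the edge itself and [k] paths of length 5.  Look at the
    set [A] of those edges over [e] that a spanning subgraph [S] retains.  The
    internal vertices of a path all stay joined to [u] or [v] exactly when the
    path has lost at most one edge; call [A] valid if no path has lost two.  Granted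
    this, all that [S] does above [e] is to join [u] to [v] or not, according
    to whether [A] contains a full branch.  Hence [S] connects [H^k(G)] iff
    every such [A] is valid and the edges of [G] with a full branch, the core
    of [S], connect [G] ([hex_spansP]).  Passing to minimal sets, [S] is a
    spanning tree iff its core is a spanning tree of [G] and no [A] has two
    full branches ([hex_minspanP]).

    The number of trees above a given core [T] is therefore a product over the
    edges of [G].  An edge outside [T] has every path cut once and no direct
    edge: [5 ^ k] ways.  An edge of [T] has one full branch, either the direct
    edge ([5 ^ k] ways to cut the paths) or one of the [k] paths ([5 ^ (k - 1)]
    ways to cut the others), that is [5 ^ (k - 1) * (k + 5)] ways.  Since every
    spanning tree of [G] has [N - 1] edges ([card_minspan]),
      [tau (H^k(G)) = (k + 5) ^ (N - 1) * 5 ^ (k * E - N + 1) * tau G]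
    ([tau_hexagonal], [tau_hexagonal_powR]).  One step multiplies [E] by
    [5 * k + 1] and adds [4 * k * E] to [N]; inserting the resulting order and
    size of [H^k_n(G)] gives the recurrence ([tau_hexnS]), and multiplying the
    recurrences gives the closed form ([tau_hexn]). *)

Set Implicit Arguments.
Unset Strict Implicit.
Unset Printing Implicit Defensive.

(** * Connecting sets of labelled edges *)

Lemma set2_eq (T : finType) (a b x y : T) :
  [set a; b] = [set x; y] -> (a = x /\ b = y) \/ (a = y /\ b = x).
Proof.
move=> E.
have: b \in [set x; y] by rewrite -E set22.
have: x \in [set a; b] by rewrite E set21.
have: y \in [set a; b] by rewrite E set22.
have: a \in [set x; y] by rewrite -E set21.
by do 4![case/set2P => ?]; subst; auto.
Qed.

(** Sets of edges are represented by sets of labels, [ends l] being the pair of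
    end points of the edge labelled [l].  The edges of the hexagonal graph have
    a product structure that is visible on labels but not on pairs of
    vertices. *)
Section LabelledEdges.
Variables (V L : finType) (ends : L -> {set V}).
Implicit Types S T : {set L}.

Definition link S : rel V := fun x y => [exists l in S, ends l == [set x; y]].

Lemma link_sym S : symmetric (link S).
Proof. by move=> x y; rewrite /link setUC. Qed.

Lemma linkW S l x y : l \in S -> ends l = [set x; y] -> link S x y.
Proof. by move=> lS El; apply/existsP; exists l; rewrite lS El eqxx. Qed.

Lemma link_subset S T x y : S \subset T -> link S x y -> link T x y.
Proof.
move=> /subsetP ST /existsP[l /andP[lS /eqP El]].
exact: linkW (ST _ lS) El.
Qed.

Lemma connect_link_sym S : connect_sym (link S).
Proof. exact: sym_connect_sym (@link_sym S). Qed.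

Lemma connect_link_subset S T x y :
  S \subset T -> connect (link S) x y -> connect (link T) x y.
Proof.
by move=> ST; apply: connect_sub => u v /(link_subset ST); apply: connect1.
Qed.

Definition spans S : bool := [forall x, forall y, connect (link S) x y].

Lemma spansP S : reflect (forall x y, connect (link S) x y) (spans S).
Proof. by apply: (iffP forallP) => H x; apply/forallP; apply: H. Qed.

(** Otherwise [U] would be closed under adjacency, hence contain everything
    reachable from [x0]. *)
Lemma exit_link S (U : {set V}) x0 y0 :
    spans S -> x0 \in U -> y0 \notin U ->
  exists x y, [/\ x \in U, y \notin U & link S x y].
Proof.
move=> /spansP spS x0U y0U; apply: contrapT => noexit.
have clU : closed (link S) (mem U).
  apply: intro_closed; first exact: connect_link_sym.
  move=> x y lxy xU; apply: contrapT => /negP yU.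
  by apply: noexit; exists x, y.
have E : (x0 \in U) = (y0 \in U) := closed_connect clU (spS x0 y0).
by rewrite -E x0U in y0U.
Qed.

(** Prim's construction: an edge leaving the current vertex set [U] adds one
    vertex and one edge.  That the chosen edges stay inside [U] is what makes
    the new edge different from them. *)
Lemma grow_tree S m : spans S -> m < #|V| ->
  exists (U : {set V}) T, [/\ #|U| = m.+1, #|T| = m, T \subset S,
    {in T, forall l, ends l \subset U} &
    {in U &, forall x y, connect (link T) x y}].
Proof.
move=> spS; elim: m => [|m IHm] ltmV.
  have [x0 _] := card_gt0P ltmV.
  exists [set x0], set0; rewrite cards1 cards0 sub0set; split=> //.
    by move=> l; rewrite inE.
  by move=> x y /set1P-> /set1P->; apply: connect0.
have [U [T [cardU cardT TS TU Uconn]]] := IHm (ltnW ltmV).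
have [x0 x0U]: exists x, x \in U by apply/card_gt0P; rewrite cardU.
have [y0 y0U]: exists y, y \in ~: U.
  by apply/card_gt0P; rewrite cardsCs setCK cardU subn_gt0.
rewrite inE in y0U.
have [x [y [xU yU /existsP[l /andP[lS /eqP El]]]]] := exit_link spS x0U y0U.
have lT : l \notin T.
  by apply: contra yU => /TU/subsetP; apply; rewrite El set22.
have TlT : T \subset l |: T by apply: subsetUr.
have xy : connect (link (l |: T)) x y.
  by apply/connect1/(@linkW _ l); rewrite ?setU11.
exists (y |: U), (l |: T); rewrite !cardsU1 yU lT cardU cardT; split=> //.
- by apply/subsetP=> l' /setU1P[->//|]; apply/subsetP.
- move=> l' /setU1P[->|/TU l'U].
    by rewrite El; apply/subsetP=> z /set2P[]->; rewrite !inE ?xU ?eqxx ?orbT.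
  by rewrite (subset_trans l'U) // subsetUr.
have to_x z : z \in y |: U -> connect (link (l |: T)) x z.
  by move=> /setU1P[->//|zU]; apply: connect_link_subset TlT (Uconn _ _ xU zU).
move=> u v /to_x xu /to_x xv; apply: connect_trans xv.
by rewrite connect_link_sym.
Qed.

Lemma spans_has_tree S : spans S -> 0 < #|V| ->
  exists T, [/\ T \subset S, spans T & #|T| = #|V|.-1].
Proof.
move=> spS V0; have ltV : #|V|.-1 < #|V| by rewrite prednK.
have [U [T [cardU cardT TS _ Uconn]]] := grow_tree spS ltV.
exists T; split=> //; apply/spansP=> x y.
have UT : U = setT.
  by apply/eqP; rewrite eqEcard subsetT cardsT cardU prednK /=.
by apply: Uconn; rewrite UT inE.
Qed.

(** The tree of the right size found inside [S] is, by minimality, [S] itself. *)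
Lemma card_minspan S : minset spans S -> 0 < #|V| -> #|S| = #|V|.-1.
Proof.
move=> /minsetP[spS minS] V0.
by have [T [TS spT <-]] := spans_has_tree spS V0; rewrite (minS T).
Qed.

End LabelledEdges.

(** * Spanning trees as minimal connecting sets *)

Section EdgeLabelling.
Variables (G : sgraph) (L : finType) (ends : L -> {set G}).

Definition edge_labelling : Prop :=
  injective ends /\ [set ends l | l : L] = edges G.

Lemma mem_edges (x y : G) : ([set x; y] \in edges G) = adj x y.
Proof.
apply/imsetP/idP => [[[a b]]|xy]; last by exists (x, y); rewrite ?inE.
rewrite inE /= => ab /set2_eq[[-> ->]//|[-> ->]]; by rewrite adj_sym.
Qed.

Lemma edge_labellingI :
    injective ends ->
    (forall l, exists x y, adj x y /\ ends l = [set x; y]) ->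
    (forall x y, adj x y -> exists l, ends l = [set x; y]) ->
  edge_labelling.
Proof.
move=> inj sound compl; split=> //; apply/setP=> A; apply/imsetP/idP.
  by case=> l _ ->; have [x [y [xy ->]]] := sound l; rewrite mem_edges.
case/imsetP=> [[x y]]; rewrite inE /= => /compl[l El] ->; by exists l.
Qed.

Hypothesis labG : edge_labelling.

Lemma labelling_surj x y : adj x y -> exists l, ends l = [set x; y].
Proof.
rewrite -mem_edges; case: labG => _ <- /imsetP[l _ ->]; by exists l.
Qed.

Lemma labelling_ends l : exists x y, adj x y /\ ends l = [set x; y].
Proof.
have: ends l \in edges G by case: labG => _ <-; apply: imset_f.
by case/imsetP => [[x y]]; rewrite inE /= => xy ->; exists x, y.
Qed.

Lemma link_adj S x y : link ends S x y -> adj x y.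
Proof.
case/existsP=> l /andP[_ /eqP El]; rewrite -mem_edges -El.
by case: labG => _ <-; apply: imset_f.
Qed.

Lemma sub_adjE (S : {set L}) : sub_adj (ends @: S) =2 link ends S.
Proof.
move=> x y; apply/andP/idP=> [[_ /imsetP[l lS El]]|lxy].
  exact: linkW lS (esym El).
split; first exact: link_adj lxy.
by case/existsP: lxy => l /andP[lS /eqP <-]; apply: imset_f.
Qed.

Lemma card_labels : #|L| = #|edges G|.
Proof. by case: labG => inj <-; rewrite card_imset. Qed.

Lemma spans_connected : is_connected G <-> spans ends setT.
Proof.
have E : @adj G =2 link ends setT.
  move=> x y; apply/idP/idP=> [/labelling_surj[l El]|/link_adj//].
  by apply: linkW El.
split=> [H|/spansP H x y]; last by rewrite (eq_connect E).
by apply/spansP=> x y; rewrite -(eq_connect E).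
Qed.

(** Removing an edge of a cycle keeps a graph connected, since the rest of the
    cycle is a detour; and if an edge of [S] can be removed without
    disconnecting, a simple path between its end points closes up with it to a
    cycle. *)
Lemma tree_minspan (S : {set L}) :
  is_tree (spanning_subgraph (ends @: S)) <-> minset (spans ends) S.
Proof.
have EC := eq_connect (sub_adjE S).
split=> [[conS acS]|/minsetP[/spansP spS minS]].
  apply/minsetP; split=> [|B /spansP spB BS].
    by apply/spansP=> x y; rewrite -EC; apply: conS.
  apply/eqP; rewrite eqEsubset BS; apply/subsetP=> l lS.
  have [x [y [xy El]]] := labelling_ends l.
  case/connectP: (spB x y) => p0 /shortenP[p pathp uniqp _] Ey {p0}.
  (* [p] joins in [B] the ends of the removed edge [l], which closes the cycle. *)
  have cyc : ucycle (sub_adj (ends @: S)) (x :: p).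
    rewrite /ucycle uniqp andbT (eq_cycle (sub_adjE S)) /= rcons_path -Ey.
    apply/andP; split; last by rewrite link_sym; apply: linkW lS El.
    by apply: sub_path pathp => u v; apply: link_subset.
  move: (acS _ cyc) pathp Ey => {cyc uniqp}; case: p => [|z [|]]//= _.
    by move=> _ Exy; rewrite Exy adj_irrefl in xy.
  rewrite andbT => /existsP[l' /andP[l'B /eqP El']] Ez.
  by rewrite (labG.1 l l') // El El' Ez.
split=> [x y|c]; first by rewrite EC; apply: spS.
rewrite /ucycle (eq_cycle (sub_adjE S)).
case: c => [|x [|y [|z r]]]//= /andP[cyc uniqc]; exfalso.
case/andP: cyc => xy /andP[yz]; rewrite rcons_path => /andP[pzr lastx].
case/existsP: (xy) => l /andP[lS /eqP El].
pose B := S :\ l.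
have keep u v : [set u; v] != [set x; y] -> link ends S u v -> link ends B u v.
  move=> uv /existsP[l' /andP[l'S /eqP El']]; apply: (linkW _ El').
  by rewrite !inE l'S andbT; apply: contra uv => /eqP E; rewrite -El' E El.
move: uniqc; rewrite !inE !negb_or -!andbA.
case/and5P=> xny xnz xnr ynz /and3P[ynr _ _].
have pathB : path (link ends B) y (z :: r).
  apply: (@sub_in_path _ (predC1 x) (link ends S)) => /=; last by rewrite yz.
    move=> u v; rewrite !inE => ux vx; apply: keep; apply/eqP=> E.
    have: x \in [set u; v] by rewrite E set21.
    by rewrite !inE !(eq_sym x) (negbTE ux) (negbTE vx).
  rewrite eq_sym xny eq_sym xnz /=; apply/allP=> w wr /=.
  by apply: contraNneq xnr => <-.
(* The detour around the deleted edge [xy] runs through [z], [r] and back to [x]. *)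
have yx : connect (link ends B) y x.
  apply: (@connect_trans _ _ (last z r)).
    by apply/connectP; exists (z :: r).
  apply/connect1/keep; last exact: lastx.
  apply/eqP=> E; have: y \in [set last z r; x] by rewrite E set22.
  have yzr : y != last z r.
    have := mem_last z r; rewrite inE => /orP[/eqP->//|].
    by apply: contraTneq => <-.
  by rewrite !inE (negbTE yzr) eq_sym (negbTE xny).
have spB : spans ends B.
  apply/spansP=> u v; apply: connect_sub (spS u v) => {}u {}v uv.
  have [/eqP/set2_eq[[-> ->]|[-> ->]]//|] := boolP ([set u; v] == [set x; y]).
    by rewrite connect_link_sym.
  by move=> /keep/(_ uv); apply: connect1.
have := minS B spB (subsetDl _ _) => /setP/(_ l).
by rewrite !inE eqxx lS.
Qed.

Lemma tauE : tau G = #|[set S : {set L} | minset (spans ends) S]|.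
Proof.
rewrite /tau -(card_imset _ (imset_inj labG.1)); apply: eq_card => F.
rewrite !inE; apply/andP/imsetP => [[sF tF]|[S]]; last first.
  rewrite inE => tS ->; split; last by apply/asboolP/tree_minspan.
  by case: labG => _ <-; apply: imsetS; apply: subset_predT.
have EF : ends @: (ends @^-1: F) = F.
  apply/eqP; rewrite eqEsubset; apply/andP; split.
    by apply/subsetP=> A /imsetP[l]; rewrite inE => lF ->.
  apply/subsetP=> A AF; case: labG (subsetP sF A AF) => _ <- /imsetP[l _ EA].
  by rewrite EA imset_f // inE -EA.
exists (ends @^-1: F) => //; rewrite inE; apply/tree_minspan.
by rewrite EF; apply/asboolP.
Qed.

End EdgeLabelling.

(** * Labelling the edges of a graph and of its hexagonal graph *)

Section OrientedEdges.
Variable G : sgraph.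

Definition oends (e : oedge G) : {set G} := [set src e; tgt e].

Lemma oedge_adj (e : oedge G) : adj (src e) (tgt e).
Proof. by case/andP: (valP e). Qed.

Lemma oedge_of_adj (u v : G) : adj u v -> exists e, oends e = [set u; v].
Proof.
move=> uv; have [lt|lt|E] := ltngtP (enum_rank u) (enum_rank v).
- have P : adj (u, v).1 (u, v).2 && (enum_rank (u, v).1 < enum_rank (u, v).2).
    by rewrite uv.
  by exists (exist _ (u, v) P).
- have P : adj (v, u).1 (v, u).2 && (enum_rank (v, u).1 < enum_rank (v, u).2).
    by rewrite adj_sym uv.
  by exists (exist _ (v, u) P); rewrite setUC.
- by move/val_inj/enum_rank_inj: E uv => ->; rewrite adj_irrefl.
Qed.

Lemma oedge_inj (e e' : oedge G) : src e = src e' -> tgt e = tgt e' -> e = e'.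
Proof.
rewrite /src /tgt => Es Et; apply: val_inj.
by move: Es Et; case: (val e) (val e') => [a b] [c d] /= -> ->.
Qed.

Lemma oedge_asym (e e' : oedge G) : src e = tgt e' -> tgt e = src e' -> False.
Proof.
move=> Es Et; case/andP: (valP e) => _; case/andP: (valP e') => _.
rewrite -/(src e) -/(tgt e) -/(src e') -/(tgt e') Es Et => lt1 lt2.
by have := ltn_trans lt1 lt2; rewrite ltnn.
Qed.

Lemma oends_labelling : edge_labelling oends.
Proof.
apply: edge_labellingI => [e e'|e|]; last exact: oedge_of_adj.
  case/set2_eq => [[Es Et]|[Es Et]]; first exact: oedge_inj.
  by case: (oedge_asym Es).
by exists (src e), (tgt e); rewrite oedge_adj.
Qed.

(** Makes the truncated [#|edges G| - #|G|.-1] of the tree count a true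
    difference. *)
Lemma connected_card_edges :
  is_connected G -> 0 < #|G| -> #|G|.-1 <= #|edges G|.
Proof.
move=> /(spans_connected oends_labelling) spG G0.
have [T [_ _ <-]] := spans_has_tree spG G0.
by rewrite -(card_labels oends_labelling) max_card.
Qed.

Lemma edges_nonempty : 0 < #|edges G| -> 0 < #|G|.
Proof. by case/card_gt0P=> A /imsetP[[x _] _ _]; apply/card_gt0P; exists x. Qed.

End OrientedEdges.

Section HexagonalLabels.
Variables (k : nat) (G : sgraph).
Implicit Types (e : oedge G) (i : 'I_k).
Local Notation H := (hexagonal k G).

(** The six vertices of path [i] above [e] in order, from [src e] (at 0) to
    [tgt e] (at 5), so that the edges of the path are indexed by ['I_5]: edge
    [j] joins vertices [j] and [j.+1]. *)
Definition node e i (j : nat) : H :=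
  match j with
  | 0 => inl (src e)
  | 1 => inr (e, i, @Ordinal 4 0 isT)
  | 2 => inr (e, i, @Ordinal 4 1 isT)
  | 3 => inr (e, i, @Ordinal 4 2 isT)
  | 4 => inr (e, i, @Ordinal 4 3 isT)
  | _ => inl (tgt e)
  end.

Lemma node_inner e i (j : 'I_4) : node e i j.+1 = inr (e, i, j).
Proof.
by case: j => [[|[|[|[|//]]]] j4] /=; congr (inr (_, _, _)); apply: val_inj.
Qed.

(** The edges that replace one edge of [G]: [None] is the edge itself, and
    [Some (i, j)] the [j]-th edge of the [i]-th path. *)
Definition slot : finType := option ('I_k * 'I_5).

Definition hex_ends (l : oedge G * slot) : {set H} :=
  match l with
  | (e, None) => [set inl (src e); inl (tgt e)]
  | (e, Some (i, j)) => [set node e i j; node e i j.+1]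
  end.

Lemma hex_ends_inj : injective hex_ends.
Proof.
have inner e i (j : 'I_5) e' :
    [set inl (src e); inl (tgt e)] != [set node e' i j; node e' i j.+1].
  apply/eqP=> /set2_eq.
  by case: j => [[|[|[|[|[|//]]]]] j5] /= [[]|[]].
move=> [e [[i j]|]] [e' [[i' j']|]] //= /eqP.
- case: j j' => [j j5] [j' j5'] /= /eqP/set2_eq EE.
  suff [-> -> Ej] : [/\ e = e', i = i' & j = j'].
    by congr (_, Some (_, _)); apply: val_inj.
  by case: j j' j5 j5' EE => [|[|[|[|[|//]]]]] [|[|[|[|[|//]]]]] _ _ [] /= [] E1 E2;
    try discriminate E1; try discriminate E2;
    injection E1; injection E2; intros; subst; split.
- by rewrite eq_sym (negbTE (inner _ _ _ _)).
- by rewrite (negbTE (inner _ _ _ _)).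
move=> /eqP/set2_eq[[[Es] [Et]]|[[Es] [Et]]]; first by rewrite (oedge_inj Es).
by case: (oedge_asym Es).
Qed.

Lemma hex_ends_adj l : exists x y, hex_adj x y /\ hex_ends l = [set x; y].
Proof.
case: l => e [[i [j j5]]|] /=; last first.
  by exists (inl (src e)), (inl (tgt e)); rewrite /= oedge_adj.
exists (node e i j), (node e i j.+1); split=> //.
by case: j j5 => [|[|[|[|[|//]]]]] _; rewrite /= ?eqxx ?orbT.
Qed.

Lemma hex_adj_ends (x y : H) : hex_adj x y -> exists l, hex_ends l = [set x; y].
Proof.
have mixed u (v : oedge G * 'I_k * 'I_4) : @hex_adj k G (inl u) (inr v) ->
    exists l, hex_ends l = [set inl u; inr v].
  case: v => [[e i] j] /= /orP[] /andP[/eqP-> /eqP Ej].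
    exists (e, Some (i, @Ordinal 5 0 isT)).
    by congr [set _; inr (_, _, _)]; apply: val_inj.
  exists (e, Some (i, @Ordinal 5 4 isT)); rewrite /= setUC.
  by congr [set _; inr (_, _, _)]; apply: val_inj.
case: x y => [u|v] [u'|v'].
- move=> /= /oedge_of_adj[e Ee]; exists (e, None) => /=.
  have /(congr1 (fun A : {set G} => (@inl G (oedge G * 'I_k * 'I_4)%type) @: A)) := Ee.
  by rewrite !imsetU1 !imset_set1.
- exact: mixed.
- by rewrite hex_adj_sym => /mixed[l El]; exists l; rewrite setUC.
case: v v' => [[e i] j] [[e' i'] j'] /= /and3P[/eqP<- /eqP<- /orP[] /eqP E].
  exists (e, Some (i, @Ordinal 5 j.+1 (ltn_ord j))) => /=.
  by rewrite -(node_inner e i j) -(node_inner e i j') -E.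
exists (e, Some (i, @Ordinal 5 j'.+1 (ltn_ord j'))) => /=.
by rewrite setUC -(node_inner e i j) -(node_inner e i j') -E.
Qed.

Lemma hex_labelling : edge_labelling (G := H) hex_ends.
Proof.
apply: edge_labellingI; first exact: hex_ends_inj.
  exact: hex_ends_adj.
exact: hex_adj_ends.
Qed.

End HexagonalLabels.

(** * What a subgraph retains above one edge *)

Section Slots.
Variable k : nat.
Local Notation slot := (slot k).
Implicit Types (A B : {set slot}) (b : option 'I_k).

(** Branches are indexed by [option 'I_k], with [None] for the direct edge. *)
Definition full A b : bool :=
  if b is Some i then [forall j, Some (i, j) \in A] else None \in A.

Definition joined A : bool := [exists b, full A b].

(** A path that has lost two edges leaves the internal vertices between them
    cut off from the rest of the graph. *)
Definition valid A : bool :=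
  [forall i, forall j, forall j',
     [|| Some (i, j) \in A, Some (i, j') \in A | j == j']].

(** These turn out to be what a spanning tree can retain above an edge. *)
Definition tight A : bool :=
  valid A && [forall b, forall b', full A b ==> full A b' ==> (b == b')].

Lemma validP A :
  reflect (forall i j j', Some (i, j) \notin A -> Some (i, j') \notin A -> j = j')
          (valid A).
Proof.
apply: (iffP forallP) => H i => [j j' Aj Aj'|].
  move/forallP/(_ j)/forallP/(_ j'): (H i).
  by rewrite (negbTE Aj) (negbTE Aj') => /eqP.
apply/forallP=> j; apply/forallP=> j'.
case: (boolP (_ \in A)) => //= Aj; case: (boolP (_ \in A)) => //= Aj'.
by apply/eqP; apply: H Aj Aj'.
Qed.

Lemma fullP A i : reflect (forall j, Some (i, j) \in A) (full A (Some i)).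
Proof. exact: forallP. Qed.

Lemma tightP A :
  reflect (valid A /\ (forall b b', full A b -> full A b' -> b = b')) (tight A).
Proof.
apply: (iffP andP) => -[vA H]; split=> //.
  move=> b b' Ab Ab'; move/forallP/(_ b)/forallP/(_ b'): H.
  by rewrite Ab Ab' => /eqP.
by apply/forallP=> b; apply/forallP=> b'; apply/implyP=> ?; apply/implyP=> ?;
  apply/eqP/H.
Qed.

Lemma full_subset A B b : B \subset A -> full B b -> full A b.
Proof.
move=> /subsetP BA; case: b => [i /fullP Bi|]; last exact: BA.
by apply/fullP=> j; apply: BA.
Qed.

Lemma joined_subset A B : B \subset A -> joined B -> joined A.
Proof.
by move=> BA /existsP[b Bb]; apply/existsP; exists b; apply: full_subset Bb.
Qed.

(** Losing an edge of the full branch of [A] unjoins the end points, since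
    there is no other full branch; losing an edge of a path that is already cut
    violates validity. *)
Lemma tight_minimal A B :
  tight A -> B \subset A -> valid B -> (joined A -> joined B) -> B = A.
Proof.
move=> /tightP[vA uA] BA /validP vB AB.
apply/eqP; rewrite eqEsubset BA; apply/subsetP=> x Ax.
have fullB b : full A b -> full B b.
  move=> Ab; have /AB/existsP[b' Bb'] : joined A by apply/existsP; exists b.
  by rewrite (uA b b') // (full_subset BA).
case: x Ax => [[i j]|]; last by move/(fullB None).
move=> Aij; apply: contraT => Bij.
suff /fullB/fullP/(_ j) : full A (Some i) by rewrite (negbTE Bij).
apply/fullP=> j'; have [->//|neq] := eqVneq j' j.
apply: (subsetP BA); apply: contraT => Bij'.
by move: neq; rewrite (vB i j' j) ?eqxx.
Qed.

(** A chosen edge of each branch, whose removal interrupts that branch and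
    nothing else. *)
Definition cut b : slot := omap (fun i => (i, ord0)) b.

Lemma full_cut A b : full A b -> cut b \in A.
Proof. by case: b => [i /fullP Ai|//]; apply: Ai. Qed.

Definition cut_off A (D : pred (option 'I_k)) : {set slot} :=
  A :\: [set cut b | b : option 'I_k & full A b && D b].

Lemma cut_off_full A D b : full (cut_off A D) b = full A b && ~~ D b.
Proof.
apply/idP/andP => [fb|[fb nDb]].
  have fAb : full A b by apply: full_subset fb; apply: subsetDl.
  split=> //; apply/negP=> Db; have := full_cut fb.
  by rewrite inE => /andP[/negP[]]; apply/imsetP; exists b; rewrite ?inE ?fAb.
have sep x : (forall b', x = cut b' -> b' = b) -> x \in A -> x \in cut_off A D.
  move=> xb Ax; rewrite inE Ax andbT; apply/imsetP=> -[b'].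
  by rewrite inE => /andP[_ Db'] /xb Eb; rewrite Eb (negbTE nDb) in Db'.
case: b fb sep {nDb} => [i /fullP Ai|AN] sep; last first.
  by apply: sep => // -[].
by apply/fullP=> j; apply: sep => // -[i'|] //= [->].
Qed.

(** Only full branches are cut, and each of them only once. *)
Lemma cut_off_valid A D : valid A -> valid (cut_off A D).
Proof.
move=> /validP vA; apply/validP=> i j j'.
have miss m : Some (i, m) \notin cut_off A D ->
    Some (i, m) \notin A \/ full A (Some i) /\ m = ord0.
  rewrite inE negb_and negbK => /orP[|]; last by left.
  by case/imsetP=> -[i'|//]; rewrite inE => /andP[fi _] [-> ->]; right.
move=> /miss[Aj|[/fullP fi ->]] /miss[Aj'|[/fullP fi' ->]] //; first exact: vA Aj Aj'.
  by rewrite fi' in Aj.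
by rewrite fi in Aj'.
Qed.

End Slots.

(** * Spanning trees of the hexagonal graph *)

Section HexagonalTrees.
Variables (k : nat) (G : sgraph).
Implicit Types (e : oedge G) (i : 'I_k) (S : {set oedge G * slot k}).
Local Notation H := (hexagonal k G).
Local Notation hex_ends := (@hex_ends k G).

Definition slice S e : {set slot k} := [set x | (e, x) \in S].

Definition core S : {set oedge G} := [set e | joined (slice S e)].

Lemma in_slice S e x : (x \in slice S e) = ((e, x) \in S).
Proof. by rewrite inE. Qed.

Lemma node_inj e e' i i' j j' : 0 < j < 5 -> j' <= 5 ->
  node e i j = node e' i' j' -> [/\ e = e', i = i' & j = j'].
Proof.
case: j j' => [|[|[|[|[|//]]]]] [|[|[|[|[|[|//]]]]]] //= _ _ E;
  try discriminate E; by injection E; intros; subst; split.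
Qed.

(** If path [i] above [e] misses the edges [j < j'], then no retained edge leaves
    the set [U] of internal vertices between them. *)
Lemma spans_valid S e : spans hex_ends S -> valid (slice S e).
Proof.
move=> spS; apply/validP=> i.
suff wlt (j j' : 'I_5) : Some (i, j) \notin slice S e ->
    Some (i, j') \notin slice S e -> ~ (j < j').
  move=> j j' Sj Sj'; case: (ltngtP j j') => [jj'|j'j|/val_inj//].
    by case: (wlt j j').
  by case: (wlt j' j).
rewrite !in_slice => Sj Sj' ltjj'.
pose U : {set H} := [set node e i m | m : 'I_5 & j < m <= j'].
have inU m : j < m <= j' -> node e i m \in U.
  move=> jmj'; have m5 : m < 5 by have := ltn_ord j'; lia.
  by apply/imsetP; exists (Ordinal m5); rewrite ?inE.
have srcU : inl (src e) \notin U.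
  apply/imsetP=> -[m]; rewrite inE => jmj' /esym Em.
  have m_inner : 0 < m < 5 by have := ltn_ord j'; lia.
  by have [_ _] := @node_inj e e i i m 0 m_inner isT Em; lia.
have [x [y [/imsetP[m]]]] := exit_link spS (inU j' ltac:(lia)) srcU.
rewrite inE => jmj' -> yU /existsP[[e' [[i' m']|]] /andP[lS /eqP/set2_eq]];
  last first.
  have node_out u : inl u = node e i m -> False.
    by move: jmj' (ltn_ord j'); case: (nat_of_ord m) => [|[|[|[|[|]]]]] //=; lia.
  by case=> [[]|[]] => [/node_out|_ /node_out].
have m_inner : 0 < m < 5 by have := ltn_ord j'; lia.
case=> -[Em Em'].
  have [Ee Ei E] := node_inj m_inner (ltnW (ltn_ord m')) (esym Em).
  have Ej : m' = j'.
    apply: val_inj => /=; apply/eqP; apply: contraR yU => neq.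
    by rewrite -Em' -Ee -Ei -E; apply: inU; lia.
  by rewrite -Ej Ee Ei lS in Sj'.
have [Ee Ei E] := node_inj m_inner (ltn_ord m') (esym Em').
have Ej : m' = j.
  apply: val_inj => /=; apply/eqP; apply: contraR yU => neq.
  by rewrite -Em -Ee -Ei; apply: inU; lia.
by rewrite -Ej Ee Ei lS in Sj.
Qed.

(** Contracts the hexagonal graph onto [G]: an internal vertex goes to [src e]
    if the retained edges lead back to [src e] along its path, and to [tgt e]
    otherwise. *)
Definition retract S (x : H) : G :=
  match x with
  | inl u => u
  | inr (e, i, j) =>
      if [forall m : 'I_5, (m <= j) ==> ((e, Some (i, m)) \in S)]
      then src e else tgt e
  end.

Lemma retract_node S e i n : n < 5 ->
  retract S (node e i n) =
    if [forall m : 'I_5, (m < n) ==> ((e, Some (i, m)) \in S)]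
    then src e else tgt e.
Proof.
case: n => [|n] n5; first by rewrite ifT //; apply/forallP.
by rewrite (node_inner e i (@Ordinal 4 n n5)).
Qed.

(** The two ends of a retained edge of a path have the same image, unless the
    edge is the last one of a full path; then [e] belongs to the core. *)
Lemma retract_link S x y : link hex_ends S x y ->
  connect (link (@oends G) (core S)) (retract S x) (retract S y).
Proof.
have Csym := connect_link_sym (@oends G) (core S).
suff H l : l \in S -> exists x y, [/\ hex_ends l = [set x; y] &
    connect (link (@oends G) (core S)) (retract S x) (retract S y)].
  case/existsP=> l /andP[/H[x' [y' [-> C]]] /eqP/set2_eq].
  by case=> -[<- <-] //; rewrite Csym.
have core_connect e : e \in core S -> connect (link (@oends G) (core S)) (src e) (tgt e).
  by move=> eS; apply/connect1/(linkW eS).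
case: l => e [[i j]|] lS; last first.
  exists (inl (src e)), (inl (tgt e)); split=> //=; apply: core_connect.
  by rewrite inE; apply/existsP; exists None; rewrite /= in_slice.
exists (node e i j), (node e i j.+1); split=> //.
rewrite retract_node //.
have nextP : [forall m : 'I_5, (m < j) ==> ((e, Some (i, m)) \in S)] =
             [forall m : 'I_5, (m < j.+1) ==> ((e, Some (i, m)) \in S)].
  apply/forallP/forallP=> P m; apply/implyP=> mj; last first.
    by apply: (implyP (P m)); apply: ltnW.
  move: mj; rewrite ltnS leq_eqVlt => /orP[/eqP/val_inj->//|].
  exact/implyP/P.
have := ltn_ord j; rewrite ltnS leq_eqVlt => /orP[/eqP Ej|j4]; last first.
  by rewrite retract_node // nextP.
rewrite nextP Ej /=; case: ifP => // /forallP P; apply: core_connect.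
rewrite inE; apply/existsP; exists (Some i); apply/fullP=> m.
by rewrite in_slice; apply: (implyP (P m)); apply: ltn_ord.
Qed.

Lemma spans_core S : spans hex_ends S -> spans (@oends G) (core S).
Proof.
move=> /spansP spS; apply/spansP=> u v.
have : connect (link hex_ends S) (inl u) (inl v) by apply: spS.
case/connectP=> p pathp Ev; rewrite -[v]/(retract S (inl v)) -[u]/(retract S (inl u)) {}Ev.
elim: p (inl u : H) pathp => [|y p IHp] x /=; first by rewrite connect0.
by case/andP=> /retract_link xy /IHp; apply: connect_trans.
Qed.

Lemma connect_run S e i a b : a <= b <= 5 ->
    (forall m : 'I_5, a <= m < b -> (e, Some (i, m)) \in S) ->
  connect (link hex_ends S) (node e i a) (node e i b).
Proof.
case/andP; elim: b => [|b IHb]; first by rewrite leqn0 => /eqP->.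
rewrite leq_eqVlt => /orP[/eqP-> //|]; rewrite ltnS => ab b5 P.
apply: (connect_trans (IHb ab (ltnW b5) _)).
  by move=> m /andP[am mb]; apply: P; rewrite am ltnW.
apply/connect1/(@linkW _ _ _ _ (e, Some (i, Ordinal b5))) => //.
by apply: P; rewrite /= ab ltnSn.
Qed.

(** Core edges are realised by their full branches, which connects the vertices
    of [G]; an internal vertex is connected to one of the two ends of its path
    because validity leaves at least one side of it intact. *)
Lemma spans_expand S : (forall e, valid (slice S e)) ->
  spans (@oends G) (core S) -> spans hex_ends S.
Proof.
move=> vS /spansP spC.
have Csym := connect_link_sym hex_ends S.
have across e : e \in core S -> connect (link hex_ends S) (inl (src e)) (inl (tgt e)).
  rewrite inE => /existsP[[i /fullP fi|]]; last first.
    by rewrite /= in_slice => eS; apply/connect1/(linkW eS).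
  by apply: (@connect_run S e i 0 5) => // m _; rewrite -in_slice.
have old u v : connect (link hex_ends S) (inl u) (inl v).
  case/connectP: (spC u v) => p pathp ->; elim: p u pathp => [|w p IHp] u /=.
    by rewrite connect0.
  case/andP=> /existsP[e /andP[/across Ce /eqP/set2_eq E]] /IHp.
  by apply: connect_trans; case: E Ce => -[-> ->] //; rewrite Csym.
have to_old x : exists u, connect (link hex_ends S) x (inl u).
  case: x => [u|[[e i] j]]; first by exists u.
  rewrite -node_inner.
  have [/forallP P|] := boolP [forall m : 'I_5, (m < j.+1) ==> ((e, Some (i, m)) \in S)].
    exists (src e); rewrite Csym; apply: (@connect_run S e i 0 j.+1).
      by have := ltn_ord j; lia.
    by move=> m /andP[_]; apply/implyP/P.
  rewrite negb_forall => /existsP[m]; rewrite negb_imply => /andP[mj mS].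
  exists (tgt e); apply: (@connect_run S e i j.+1 5).
    by have := ltn_ord j; lia.
  move=> m' /andP[jm' _]; apply: contraT => m'S.
  have := validP _ (vS e) i m m'; rewrite !in_slice => /(_ mS m'S) E.
  by move: jm' mj; rewrite E; lia.
apply/spansP=> x y; have [u xu] := to_old x; have [v yv] := to_old y.
by apply: connect_trans xu (connect_trans (old u v) _); rewrite Csym.
Qed.

Lemma hex_spansP S :
  reflect ((forall e, valid (slice S e)) /\ spans (@oends G) (core S))
          (spans hex_ends S).
Proof.
apply: (iffP idP) => [spS|[vS spC]]; last exact: spans_expand.
by split=> [e|]; [apply: spans_valid|apply: spans_core].
Qed.

(** A minimal [S] cannot be pruned: cutting any selection of full branches that
    leaves the core connecting must be vacuous.  Cutting all the branches over
    the complement of a smaller connecting set [T] shows that the core is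
    minimal, and cutting one of two full branches over the same edge shows that
    the slices are tight. *)
Lemma hex_minspanP S :
  reflect (minset (spans (@oends G)) (core S) /\ forall e, tight (slice S e))
          (minset (spans hex_ends) S).
Proof.
apply: (iffP idP) => [/minsetP[/hex_spansP[vS spC] minS]|[/minsetP[spC minC] tS]];
    last first.
  apply/minsetP; split.
    by apply/hex_spansP; split=> // e; case/tightP: (tS e).
  move=> S' /hex_spansP[vS' spC'] S'S.
  have sub e : slice S' e \subset slice S e.
    by apply/subsetP=> x; rewrite !in_slice; apply/subsetP.
  have coreE : core S' = core S.
    apply: minC spC' _; apply/subsetP=> e; rewrite !inE.
    exact: joined_subset.
  apply/setP=> -[e x]; rewrite -!in_slice; congr (_ \in pred_of_set _).
  apply: tight_minimal => //; move/setP/(_ e): coreE; rewrite !inE.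
  by move=> ->.
(* [D e b] selects the branch [b] above [e] for cutting. *)
have prune (D : oedge G -> pred (option 'I_k)) :
    spans (@oends G) [set e | [exists b, full (slice S e) b && ~~ D e b]] ->
    forall e b, full (slice S e) b -> ~~ D e b.
  pose S' := [set l in S | l.2 \in cut_off (slice S l.1) (D l.1)] => spD.
  have sliceS' e : slice S' e = cut_off (slice S e) (D e).
    apply/setP=> x; rewrite in_slice inE /= -in_slice.
    by apply: andb_idl; apply/subsetP/subsetDl.
  have coreS' : core S' = [set e | [exists b, full (slice S e) b && ~~ D e b]].
    apply/setP=> e; rewrite !inE sliceS'.
    by apply: eq_existsb => b; apply: cut_off_full.
  have ES : S' = S.
    apply: minS; last by apply/subsetP=> l; rewrite inE => /andP[].
    by apply/hex_spansP; rewrite coreS'; split=> // e; rewrite sliceS' cut_off_valid.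
  move=> e b; have := cut_off_full (slice S e) (D e) b.
  by rewrite -sliceS' ES => -> /andP[].
split.
  apply/minsetP; split=> // T spT TC.
  apply/eqP; rewrite eqEsubset TC; apply/subsetP=> e.
  rewrite inE => /existsP[b fb]; rewrite -[e \in T]negbK.
  apply: (prune (fun e' _ => e' \notin T)) (fb).
  suff -> : [set e' | [exists b', full (slice S e') b' && ~~ (e' \notin T)]] = T by [].
  apply/setP=> e'; rewrite inE; apply/existsP/idP => [[b' /andP[_ /negbNE//]]|e'T].
  by have := subsetP TC e' e'T; rewrite inE => /existsP[b' fb']; exists b'; rewrite fb' e'T.
move=> e; apply/tightP; split=> // b b' fb fb'.
apply: contrapT => neq.
suff /prune/(_ e b fb) : spans (@oends G)
    [set e' | [exists b0, full (slice S e') b0 && ~~ ((e' == e) && (b0 == b))]].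
  by rewrite !eqxx.
suff -> : [set e' | [exists b0, full (slice S e') b0 && ~~ ((e' == e) && (b0 == b))]]
  = core S by [].
apply/setP=> e'; rewrite !inE; apply/existsP/existsP => [[b0 /andP[fb0 _]]|[b0 fb0]].
  by exists b0.
have [E|neqe] := eqVneq e' e; last by exists b0; rewrite fb0.
by exists b'; rewrite E fb' /=; apply/eqP=> E'; apply: neq.
Qed.

End HexagonalTrees.

(** * Counting *)

Section TightStates.
Variable k : nat.
Local Notation slot := (slot k).
Implicit Types (A B : {set slot}) (b : option 'I_k) (o : option (option 'I_k)).
Implicit Types (f : {ffun 'I_k -> 'I_5}).

(** Path [i] loses its edge [f i], except that the branch designated by [o], if
    any, is kept full; [o = None] means that no branch is full. *)
Definition tight_set o f : {set slot} :=
  [set x | if x is Some (i, j) then (j != f i) || (o == Some (Some i))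
           else o == Some None].

Lemma in_tight_set o f i j :
  (Some (i, j) \in tight_set o f) = (j != f i) || (o == Some (Some i)).
Proof. by rewrite inE. Qed.

Lemma full_tight_set o f b : full (tight_set o f) b = (o == Some b).
Proof.
case: b => [i|] /=; last by rewrite inE.
apply/forallP/idP => [/(_ (f i))|oi j]; rewrite in_tight_set ?eqxx ?oi ?orbT //.
Qed.

Lemma tight_tight_set o f : tight (tight_set o f).
Proof.
apply/tightP; split=> [|b b']; last by rewrite !full_tight_set => /eqP-> /eqP[].
apply/validP=> i j j'; rewrite !in_tight_set !negb_or !negbK.
by move=> /andP[/eqP-> _] /andP[/eqP-> _].
Qed.

(** When path [i] is kept full, [tight_set o f] does not depend on [f i]; this
    value is fixed to [ord0] so that [tight_set o] becomes injective. *)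
Definition gaps o : {set {ffun 'I_k -> 'I_5}} :=
  [set f : {ffun 'I_k -> 'I_5} | if o is Some (Some i) then f i == ord0 else true].

Lemma tight_set_inj o : {in gaps o &, injective (tight_set o)}.
Proof.
move=> f f'; rewrite !inE => fo f'o E; apply/ffunP=> i.
have [Eo|oi] := boolP (o == Some (Some i)).
  by move: fo f'o; rewrite (eqP Eo) => /eqP-> /eqP->.
have := in_tight_set o f' i (f i).
by rewrite -E in_tight_set eqxx (negbTE oi) !orbF /= => /esym/negbFE/eqP.
Qed.

Lemma tight_set_surj o A : tight A -> (forall b, full A b = (o == Some b)) ->
  exists2 f, f \in gaps o & A = tight_set o f.
Proof.
move=> /tightP[/validP vA _] fA.
pose f := [ffun i : 'I_k => odflt ord0 [pick j | Some (i, j) \notin A]].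
have fP i : ~~ full A (Some i) -> Some (i, f i) \notin A.
  rewrite negb_forall => /existsP[j Aj]; rewrite ffunE.
  by case: pickP => // /(_ j); rewrite Aj.
exists f.
  rewrite inE; case: o fA => [[i|]|] // fA.
  have /fullP Ai : full A (Some i) by rewrite fA.
  rewrite ffunE; case: pickP => // j; by rewrite Ai.
apply/setP=> -[[i j]|]; last by rewrite inE -fA.
rewrite in_tight_set -fA; have [/fullP ->|nfi] := boolP (full A (Some i)).
  by rewrite orbT.
rewrite orbF; have [->|neq] := eqVneq j (f i); first exact/negbTE/fP.
by apply: contraNT neq => Aj; apply/eqP/(vA i) => //; apply: fP.
Qed.

Lemma card_tight_by_join o :
  #|[set A : {set slot} | tight A && [forall b, full A b == (o == Some b)]]|
  = #|gaps o|.
Proof.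
rewrite -(card_in_imset (@tight_set_inj o)); apply: eq_card => A.
rewrite inE; apply/andP/imsetP => [[tA /forallP fA]|[f _ ->]]; last first.
  by split; [apply: tight_tight_set|apply/forallP=> b; rewrite full_tight_set].
have [b|f fo ->] := @tight_set_surj o A tA; first exact/eqP/fA.
by exists f.
Qed.

Lemma card_gaps_free o : (forall i, o != Some (Some i)) -> #|gaps o| = 5 ^ k.
Proof.
move=> oi; transitivity #|{ffun 'I_k -> 'I_5}|; last first.
  by rewrite card_ffun !card_ord.
apply: eq_card => f; rewrite !inE; case: o oi => [[i|]|] //.
by move=> /(_ i)/eqP.
Qed.

(** Such choices are the functions supported outside [i], [ord0] being the
    default value. *)
Lemma card_gaps_path i : #|gaps (Some (Some i))| = 5 ^ k.-1.
Proof.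
transitivity #|pffun_on (ord0 : 'I_5) (predC1 i) (predT : pred 'I_5)|; last first.
  by rewrite card_pffun_on cardC1 !card_ord.
apply: eq_card => f; rewrite inE; apply/eqP/pffun_onP => [fi|[/subsetP supp _]].
  split=> //; apply/subsetP=> x; rewrite !inE.
  by apply: contraNneq => ->; rewrite fi.
by apply/eqP; apply: contraT => fi; have := supp i fi; rewrite !inE eqxx.
Qed.

Lemma card_tight_apart :
  #|[set A : {set slot} | tight A && ~~ joined A]| = 5 ^ k.
Proof.
rewrite -(@card_gaps_free None) // -card_tight_by_join; apply: eq_card => A.
rewrite !inE negb_exists; congr (_ && _); apply: eq_forallb => b.
by rewrite eqbF_neg.
Qed.

(** The unique full branch is the direct edge, with [k] paths to cut, or one of
    the [k] paths, with [k.-1] other paths to cut. *)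
Lemma card_tight_joined :
  #|[set A : {set slot} | tight A && joined A]| = 5 ^ k + k * 5 ^ k.-1.
Proof.
(* Only joined sets are summed over, so that [pick] finds a full branch. *)
pose join_of A := odflt None [pick b | full A b].
have join_ofE A b : tight A && joined A && (join_of A == b) =
    tight A && [forall b', full A b' == (Some b == Some b')].
  rewrite /join_of; case: (boolP (tight A)) => //= /tightP[_ uA].
  apply/andP/forallP => [[/existsP[b0 fb0] /eqP <-] b'|fA].
    case: pickP => [b1 fb1|/(_ b0)]; last by rewrite fb0.
    apply/eqP; apply/idP/eqP => [fb'|[<-]//]; congr Some; exact: uA.
  have fb : full A b by rewrite (eqP (fA b)).
  split; first by apply/existsP; exists b.
  by case: pickP => [b1 fb1|/(_ b)]; rewrite ?fb //= (uA _ _ fb fb1).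
rewrite -sum1dep_card (partition_big join_of predT) //=.
under eq_bigr => b _.
  rewrite (eq_bigl _ _ (join_ofE^~ b)) sum1dep_card card_tight_by_join.
over.
rewrite (bigD1 None) //= card_gaps_free //; congr (_ + _).
rewrite (reindex_omap Some id) /=; last by case.
under eq_bigr => i _ do rewrite card_gaps_path.
rewrite sum_nat_const; congr (_ * _).
by rewrite -[RHS]card_ord; apply: eq_card => i; apply: (eqxx i).
Qed.

End TightStates.

Section Count.
Variables (k : nat) (G : sgraph).

(** Slices above different edges can be chosen independently, membership in the
    core being decided edge by edge. *)
Lemma card_fibre (T : {set oedge G}) :
  #|[set S : {set oedge G * slot k} |
      (core S == T) && [forall e, tight (slice S e)]]|
  = (5 ^ k + k * 5 ^ k.-1) ^ #|T| * (5 ^ k) ^ #|~: T|.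
Proof.
pose F e := [set A : {set slot k} | tight A && (joined A == (e \in T))].
pose glue (h : {ffun oedge G -> {set slot k}}) := [set l | l.2 \in h l.1].
have glueK e h : slice (glue h) e = h e by apply/setP=> x; rewrite in_slice inE.
have glue_inj : injective glue.
  by move=> h h' E; apply/ffunP=> e; rewrite -!glueK E.
transitivity #|family F|.
  rewrite -(card_imset _ glue_inj); apply: eq_card => S; rewrite inE.
  apply/andP/imsetP => [[/eqP coreE /forallP tS]|[h /familyP hF ->]].
    exists [ffun e => slice S e].
      by apply/familyP=> e; rewrite ffunE inE tS -coreE inE eqxx.
    by apply/setP=> -[e x]; rewrite inE ffunE in_slice.
  split; last first.
    by apply/forallP=> e; rewrite glueK; have := hF e; rewrite inE => /andP[].
  apply/eqP/setP=> e; rewrite inE glueK.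
  by have := hF e; rewrite inE => /andP[_ /eqP].
rewrite card_family foldrE big_map big_enum /= (bigID (mem T)) /=.
congr (_ * _).
  rewrite (eq_bigr (fun=> 5 ^ k + k * 5 ^ k.-1)) ?prod_nat_const //= => e eT.
  rewrite -card_tight_joined; apply: eq_card => A.
  by rewrite !inE eT eqb_id.
rewrite (eq_bigr (fun=> 5 ^ k)) => [|e eT].
  by rewrite prod_nat_const; congr (_ ^ _); apply: eq_card => e; rewrite !inE.
rewrite -card_tight_apart; apply: eq_card => A.
by rewrite !inE (negbTE eT) eqbF_neg.
Qed.

Lemma tau_hexagonal : 0 < #|G| ->
  tau (hexagonal k G) =
  (5 ^ k + k * 5 ^ k.-1) ^ #|G|.-1 * (5 ^ k) ^ (#|edges G| - #|G|.-1) * tau G.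
Proof.
move=> G0; rewrite (tauE (@hex_labelling k G)) (tauE (@oends_labelling G)).
rewrite -sum1dep_card.
rewrite (eq_bigl (fun S => minset (spans (@oends G)) (core S) &&
                           [forall e, tight (slice S e)])); last first.
  by move=> S; apply/hex_minspanP/andP => -[? /forallP].
rewrite (partition_big (@core k G) (minset (spans (@oends G)))) => /=; last first.
  by move=> S /andP[].
rewrite -sum1dep_card big_distrr /=; apply: eq_bigr => T minT.
rewrite muln1 -(card_minspan minT G0) -(card_labels (@oends_labelling G)).
have -> : #|{: oedge G}| - #|T| = #|~: T| by rewrite [RHS]cardsCs setCK.
rewrite -card_fibre -sum1dep_card.
apply: eq_bigl => S; case: eqP => [->|]; rewrite ?andbF // andbT minT.
by [].
Qed.

End Count.

(** * Iterating the construction *)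

Section Iteration.
Variable k : nat.

Lemma card_hexagonal (G : sgraph) :
  #|hexagonal k G| = #|G| + 4 * k * #|edges G|.
Proof.
rewrite card_sum !card_prod !card_ord (card_labels (@oends_labelling G)).
by rewrite -mulnA mulnC (mulnC k).
Qed.

Lemma card_edges_hexagonal (G : sgraph) :
  #|edges (hexagonal k G)| = (5 * k + 1) * #|edges G|.
Proof.
rewrite -(card_labels (@hex_labelling k G)) card_prod card_option card_prod.
by rewrite !card_ord (card_labels (@oends_labelling G)) mulnC addn1 (mulnC k).
Qed.

Lemma hexagonal_connected (G : sgraph) :
  is_connected G -> is_connected (hexagonal k G).
Proof.
move=> /(spans_connected (@oends_labelling G)) spG.
apply/(spans_connected (@hex_labelling k G))/hex_spansP.
have sliceT e : slice [set: oedge G * slot k] e = setT.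
  by apply/setP=> x; rewrite !inE.
split=> [e|]; first by rewrite sliceT; apply/validP=> i j j'; rewrite inE.
suff -> : core [set: oedge G * slot k] = setT by [].
apply/setP=> e; rewrite !inE sliceT; apply/existsP; exists None.
by rewrite /= inE.
Qed.

Lemma hexn_connected (G : sgraph) n : is_connected G -> is_connected (hexn k n G).
Proof. by move=> cG; elim: n => //= n; apply: hexagonal_connected. Qed.

Lemma card_edges_hexn (G : sgraph) n :
  #|edges (hexn k n G)| = (5 * k + 1) ^ n * #|edges G|.
Proof.
elim: n => [|n IHn] /=; first by rewrite mul1n.
by rewrite card_edges_hexagonal IHn mulnA -expnS.
Qed.

Lemma hexn_nonempty (G : sgraph) n : 0 < #|G| -> 0 < #|hexn k n G|.
Proof. by move=> G0; elim: n => //= n IHn; rewrite card_hexagonal ltn_addr. Qed.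

End Iteration.

Local Open Scope ring_scope.
Import Order.TTheory GRing.Theory Num.Theory.

Section RealForm.
Variables (R : realType) (k : nat).
Hypothesis k_gt0 : (0 < k)%N.
Let K : R := k%:R.

(** The count of [tau_hexagonal], with [5 ^ k + k * 5 ^ k.-1] factored as
    [(k + 5) * 5 ^ k.-1] and the powers of 5 collected. *)
Lemma tau_hexagonal_powR (G : sgraph) : is_connected G -> (0 < #|G|)%N ->
  (tau (hexagonal k G))%:R =
  (K + 5) `^ (#|G|%:R - 1) * 5 `^ (K * #|edges G|%:R - #|G|%:R + 1)
  * (tau G)%:R :> R.
Proof.
move=> cG G0; rewrite tau_hexagonal //.
have leE := connected_card_edges cG G0.
move: G0 leE; move: #|G| #|edges G| (tau G) => [//|a] E t _ /= leE.
have EE : (E%:R = a%:R + (E - a)%:R :> R) by rewrite -natrD subnKC.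
(* [a] edges in a tree and [b] outside it: the size is [a + b], the order [a + 1]. *)
rewrite EE; move: (E - a)%N => b {leE EE E}.
rewrite {}/K; case: k k_gt0 => [//|k'] _ /=.
have -> : (5 ^ k'.+1 + k'.+1 * 5 ^ k' = (k'.+1 + 5) * 5 ^ k')%N.
  by rewrite expnS mulnDl addnC.
have -> : (((k'.+1 + 5) * 5 ^ k') ^ a * (5 ^ k'.+1) ^ b
           = (k'.+1 + 5) ^ a * 5 ^ (k' * a + k'.+1 * b))%N.
  by rewrite expnMn -!expnM -mulnA -expnD.
have -> : a.+1%:R - 1 = a%:R :> R by rewrite -natr1 addrK.
have -> : k'.+1%:R * (a%:R + b%:R) - a.+1%:R + 1
        = (k' * a + k'.+1 * b)%:R :> R.
  by rewrite natrD !natrM -!natr1; ring.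
by rewrite !powR_mulrn ?addr_ge0 ?ler0n // !natrM !natrX natrD.
Qed.

Lemma card_hexn (G : sgraph) n :
  #|hexn k n G|%:R =
  #|G|%:R + 4 / 5 * ((5 * K + 1) ^+ n - 1) * #|edges G|%:R :> R.
Proof.
elim: n => [|n IHn] /=; first by rewrite expr0 subrr mulr0 mul0r addr0.
rewrite card_hexagonal card_edges_hexn natrD IHn !natrM natrX natrD natrM exprS -/K.
by field.
Qed.

Lemma tau_hexnS (G : sgraph) n : is_connected G -> (0 < #|G|)%N ->
  let N0 : R := #|G|%:R in
  let E0 : R := #|edges G|%:R in
  let q : R := (5 * K + 1) ^+ n in
  (tau (hexn k n.+1 G))%:R =
  (K + 5) `^ (N0 + 4 / 5 * (q - 1) * E0 - 1)
  * 5 `^ (((5 * K - 4) / 5 * q + 4 / 5) * E0 - N0 + 1)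
  * (tau (hexn k n G))%:R.
Proof.
move=> cG G0 N0 E0 q; rewrite /= tau_hexagonal_powR; first last.
- exact: hexn_nonempty.
- exact: hexn_connected.
rewrite card_hexn card_edges_hexn natrM natrX natrD natrM -/K -/q -/N0 -/E0.
by congr (_ * 5 `^ _ * _); field.
Qed.

Lemma tau_hexn (G : sgraph) n : is_connected G -> (0 < #|G|)%N ->
  let N0 : R := #|G|%:R in
  let E0 : R := #|edges G|%:R in
  let m : R := n%:R in
  let xi : R := \sum_(0 <= i < n) (5 * K + 1) ^+ i in
  (tau (hexn k n G))%:R =
  (K + 5) `^ (m * (N0 - 4 / 5 * E0 - 1) + 4 / 5 * xi * E0)
  * 5 `^ (m * (4 / 5 * E0 - N0 + 1) + (5 * K - 4) / 5 * xi * E0)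
  * (tau G)%:R.
Proof.
move=> cG G0 N0 E0 m xi; rewrite {}/m {}/xi; elim: n => [|n IHn].
  by rewrite big_nil !mul0r !mulr0 !mul0r !addr0 !powRr0 !mul1r.
rewrite tau_hexnS // IHn big_nat_recr //= mulrA mulrACA.
have K5 : K + 5 != 0 by rewrite gt_eqF // ltr_wpDl ?ler0n.
have five : 5 != 0 :> R by rewrite pnatr_eq0.
rewrite -!powRD ?K5 ?five ?implybT // -/N0 -/E0 -natr1.
by congr (_ `^ _ * _ `^ _ * _); field.
Qed.

End RealForm.

Theorem theorem3p6 (R : realType) (G : sgraph) (k n : nat)
    (connG : is_connected G) (edgeG : (1 <= #|edges G|)%N)
    (k_ge2 : (2 <= k)%N) (n_ge1 : (1 <= n)%N) :
  let N0 : R := #|G|%:R in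
  let E0 : R := #|edges G|%:R in
  let K : R := k%:R in
  let m : R := n%:R in
  let xi : R := \sum_(0 <= i < n) (5 * K + 1) ^+ i in
  [/\ (tau (hexn k n G))%:R =
        (K + 5) `^ (N0 + 4 / 5 * ((5 * K + 1) ^+ (n - 1) - 1) * E0 - 1)
        * 5 `^ (((5 * K - 4) / 5 * (5 * K + 1) ^+ (n - 1) + 4 / 5) * E0
                - N0 + 1)
        * (tau (hexn k (n - 1) G))%:R,
      (tau (hexn k n G))%:R =
        (K + 5) `^ (m * (N0 - 4 / 5 * E0 - 1) + 4 / 5 * xi * E0)
        * 5 `^ (m * (4 / 5 * E0 - N0 + 1) + (5 * K - 4) / 5 * xi * E0)
        * (tau G)%:R
    & xi = ((5 * K + 1) ^+ n - 1) / (5 * K)].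
Proof.
move=> N0 E0 K m xi.
have k_gt0 : (0 < k)%N := ltnW k_ge2.
have G0 := edges_nonempty edgeG.
split; last 1 first.
- have K0 : 5 * K != 0 by rewrite -natrM pnatr_eq0 muln_eq0 -lt0n.
  by rewrite subrX1 addrK mulrC mulrA mulVf // mul1r /xi big_mkord.
- by rewrite subn1 -[in LHS](prednK n_ge1); apply: tau_hexnS.
- exact: tau_hexn.
Qed.
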